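(* In the setting described in the context, let $\beta_t$ ($t\ge 1$) denote the policy computed by LPSM at slot $t$. Then $$\mathbb{E}\Big[\,1+\sum_{t=1}^{\infty}\mathbb{I}\{\beta_t\neq\beta^*\}\Big]\;\le\;1+\frac{(1+A)\,S}{e^{\frac12\left(\frac{\Delta_1}{B_0}\right)^2}-1},$$ i.e. the expected number of slots in which LPSM plays a non-optimal policy (counting slot $0$, where an arbitrary action is played) is at most this quantity.
   Context: Setting (MDP with unknown mean rewards). $\mathcal{S}$ is a finite state space and $\mathcal{A}$ a finite action set, with $S=|\mathcal{S}|$, $A=|\mathcal{A}|$; for each $s\in\mathcal{S}$ a nonempty set $\mathcal{A}_s\subseteq\mathcal{A}$ of allowed actions is given. The transition probabilities $P(s'\mid s,a)$ are known to the agent. The MDP is ergodic: every deterministic stationary policy $\beta:\mathcal{S}\to\mathcal{A}$ with $\beta(s)\in\mathcal{A}_s$ induces an irreducible aperiodic Markov chain; let $\pi_\beta$ be its stationary distribution. Let $X_0,X_1,\dots$ be i.i.d. random variables with support $\mathcal{X}$. If at slot $t$ the state is $s_t$ and action $a_t\in\mathcal{A}_{s_t}$ is taken, the agent receives reward $r_t=f(s_t,a_t,X_t)$, where the function $f$ is known to the agent, the next state $s_{t+1}$ is drawn from $P(\cdot\mid s_t,a_t)$, and after slot $t$ the agent learns the realization $x_t$ of $X_t$. The initial state $s_0$ is arbitrary. Let $\mu(s,a)=\mathbb{E}[f(s,a,X)]$ and let $\mathbf{M}$ be the matrix with entries $\mu(s,a)$. For any matrix $\Theta$ with entries $\Theta(s,a)$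 and policy $\beta$, set $\rho(\beta,\Theta)=\sum_{s\in\mathcal{S}}\pi_\beta(s)\Theta(s,\beta(s))$. Let $\beta^*$ be an optimal deterministic stationary policy, $\rho^*=\rho(\beta^*,\mathbf{M})=\max_\beta\rho(\beta,\mathbf{M})$, and $\Delta_1=\rho^*-\max_{\beta\neq\beta^*}\rho(\beta,\mathbf{M})$. Let $B(s,a)\ge\sup_{x\in\mathcal{X}}f(s,a,x)-\inf_{x\in\mathcal{X}}f(s,a,x)$ and $B_0=\max_{(s,a)}B(s,a)$ (finite). A fraction $c/0$ with $c>0$ is read as $+\infty$. LP$(\Theta)$: maximize $\sum_{s}\sum_{a\in\mathcal{A}_s}\pi(s,a)\Theta(s,a)$ subject to $\pi(s,a)\ge 0$, $\sum_s\sum_{a\in\mathcal{A}_s}\pi(s,a)=1$, and $\sum_{a\in\mathcal{A}_{s'}}\pi(s',a)=\sum_s\sum_{a\in\mathcal{A}_s}\pi(s,a)P(s'\mid s,a)$ for all $s'\in\mathcal{S}$. Algorithm LPSM: at slot $0$ play any allowed action. At each slot $n\ge 1$, let $\Theta_n(s,a)=\frac1n\sum_{k=0}^{n-1}f(s,a,x_k)$ for all allowed pairs $(s,a)$, solve LP$(\Theta_n)$ to obtain a solution $\pi_{(n)}$, define $\beta_n(s)\in\arg\max_{a\in\mathcal{A}_s}\pi_{(n)}(s,a)$ for every $s$, and play $\beta_n(s_n)$. *)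

(* Defs.v *)
From HB Require Import structures.
From mathcomp Require Import all_boot all_order all_algebra.
From mathcomp Require Import all_classical all_reals all_analysis.
Set Implicit Arguments. Unset Strict Implicit. Unset Printing Implicit Defensive.
Import Order.TTheory GRing.Theory Num.Theory.
Local Open Scope classical_set_scope.
Local Open Scope ring_scope.

Section MC.
Variables (R : realType) (S : finType).

Fixpoint mpow (Q : S -> S -> R) (n : nat) : S -> S -> R :=
  match n with
  | 0 => fun i j => if i == j then 1 else 0
  | n'.+1 => fun i j => \sum_(k : S) mpow Q n' i k * Q k j
  end.

Definition stochastic (Q : S -> S -> R) :=
  (forall i j, 0 <= Q i j) /\ (forall i, \sum_(j : S) Q i j = 1).

Definition irreducible (Q : S -> S -> R) :=
  forall i j, exists n, 0 < mpow Q n i j.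

(* period of every state equals 1: gcd {n >= 1 | Q^n(i,i) > 0} = 1, i.e. no
   d > 1 divides every return time *)
Definition aperiodic (Q : S -> S -> R) :=
  forall i, ~ exists d : nat, (1 < d)%N /\
     (forall n : nat, (1 <= n)%N -> 0 < mpow Q n i i -> (d %| n)%N).

Definition stationary (Q : S -> S -> R) (p : S -> R) :=
  (forall s, 0 <= p s) /\ \sum_(s : S) p s = 1 /\
  (forall s', p s' = \sum_(s : S) p s * Q s s').
End MC.

Section MDP.
Variables (R : realType) (S A : finType).

Definition policy := {ffun S -> A}.

Definition allowed_policy (As : S -> {set A}) (b : policy) :=
  forall s, b s \in As s.

Definition chain_of (P : S -> A -> S -> R) (b : policy) : S -> S -> R :=
  fun s s' => P s (b s) s'.

Definition rho (pib : S -> R) (b : policy) (Th : S -> A -> R) : R :=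
  \sum_(s : S) pib s * Th s (b s).

Definition LP_feasible (As : S -> {set A}) (P : S -> A -> S -> R)
    (p : S -> A -> R) :=
  (forall s a, a \in As s -> 0 <= p s a) /\
  \sum_(s : S) \sum_(a in As s) p s a = 1 /\
  (forall s', \sum_(a in As s') p s' a =
              \sum_(s : S) \sum_(a in As s) p s a * P s a s').

Definition LP_obj (As : S -> {set A}) (Th : S -> A -> R) (p : S -> A -> R) :=
  \sum_(s : S) \sum_(a in As s) p s a * Th s a.

Definition LP_optimal (As : S -> {set A}) (P : S -> A -> S -> R)
    (Th : S -> A -> R) (p : S -> A -> R) :=
  LP_feasible As P p /\
  forall q, LP_feasible As P q -> LP_obj As Th q <= LP_obj As Th p.

Definition argmax_policy (As : S -> {set A}) (p : S -> A -> R) (b : policy) :=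
  forall s, b s \in As s /\ forall a, a \in As s -> p s a <= p s (b s).

Definition B0 (As : S -> {set A}) (B : S -> A -> R) : R :=
  \big[Num.max/0]_(s : S) \big[Num.max/0]_(a in As s) B s a.
End MDP.

Definition Theta (R : realType) (S A X : Type) (f : S -> A -> X -> R)
   (x : nat -> X) (n : nat) : S -> A -> R :=
  fun s a => n%:R^-1 * \sum_(k < n) f s a (x k).

Definition iid (R : realType) (d : measure_display) (T : measurableType d)
  (P : probability T R) (dX : measure_display) (X : measurableType dX)
  (Xs : nat -> T -> X) : Prop :=
  (forall n, measurable_fun setT (Xs n)) /\
  (forall n (B : set X), measurable B ->
      P (Xs n @^-1` B) = P (Xs 0%N @^-1` B)) /\
  (forall (I : seq nat) (B : nat -> set X), uniq I ->
      (forall i, measurable (B i)) ->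
      P (\bigcap_(i in [set` I]) (Xs i @^-1` B i)) =
      \prod_(i <- I) P (Xs i @^-1` B i))%E.

Local Open Scope ereal_scope.
(* c / D with c > 0 read as +oo when D = 0 *)
Definition ediv_pos (R : realType) (c : R) (D : \bar R) : \bar R :=
  match D with
  | EFin r => if r == 0%R then +oo else (c / r)%:E
  | +oo => 0
  | -oo => -oo
  end.

Definition expm1_ext (R : realType) (z : \bar R) : \bar R :=
  match z with
  | EFin r => (expR r - 1)%:E
  | +oo => +oo
  | -oo => (-1)%:E
  end.

(* (1/2)(Delta1/B0)^2 where Delta1 in [0,+oo] (+oo when there is no
   other allowed policy) and B0 >= 0; c/0 = +oo for c > 0, and 0/0 := 0 *)
Definition half_sq_ratio (R : realType) (Delta1 : \bar R) (b0 : R) : \bar R :=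
  match Delta1 with
  | EFin dl => if dl == 0%R then 0
               else if b0 == 0%R then +oo
               else ((dl / b0) ^+ 2 / 2)%:E
  | +oo => +oo
  | -oo => 0
  end.

Definition allowedb (S A : finType) (As : S -> {set A}) (b : policy S A) : bool :=
  [forall s, b s \in As s].

(* Delta_1 = rho* - max_{beta <> beta*} rho(beta, M), as an extended real;
   equals +oo when beta* is the only allowed deterministic policy *)
Definition Delta1 (R : realType) (S A : finType) (As : S -> {set A})
    (pi : policy S A -> S -> R) (M : S -> A -> R) (bstar : policy S A)
    : \bar R :=
  (rho (pi bstar) bstar M)%:E -
  \big[Order.max/-oo]_(b : policy S A | allowedb As b && (b != bstar))
     (rho (pi b) b M)%:E.

(* Main.v *)
(** The idea: if the optimal policy [bstar] is, for the empirical rewards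
    [Theta], strictly better than each of its one-state deviations, then the
    Poisson equation of its chain shows that all its off-policy advantages are
    negative, so every LP optimum is supported on [bstar] and LPSM plays it.
    Otherwise some deviation has [Theta]-value at least that of [bstar] although
    its true value is smaller by [Delta_1]; hence either some [Theta s a]
    exceeds its mean by [Delta_1 / 2] ([S A] events), or some
    [Theta s (bstar s)] falls below its mean by [Delta_1 / 2] ([S] events).
    Hoeffding's inequality and a geometric series give the bound. *)
Require Import Defs.
From HB Require Import structures.
From mathcomp Require Import all_boot all_order all_algebra.
From mathcomp Require Import all_classical all_reals all_analysis.
From mathcomp Require Import measurable_realfun.
From mathcomp Require Import ring lra.
Import Order.TTheory GRing.Theory Num.Theory.
Local Open Scope classical_set_scope.
Local Open Scope ring_scope.
Set Implicit Arguments. Unset Strict Implicit. Unset Printing Implicit Defensive.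

(** * Stationary chains and the linear program *)

Lemma mpow_ge0 (R : realType) (S : finType) (Q : S -> S -> R) n i j :
  stochastic Q -> 0 <= mpow Q n i j.
Proof.
move=> [Q0 _]; elim: n j => [|n IHn] j /=; first by case: ifP.
by apply: sumr_ge0 => k _; exact: mulr_ge0.
Qed.

Lemma mpow_sum1 (R : realType) (S : finType) (Q : S -> S -> R) n i :
  stochastic Q -> \sum_j mpow Q n i j = 1.
Proof.
move=> [_ Q1]; elim: n => [|n IHn] /=.
  by rewrite (bigD1 i)//= eqxx big1 ?addr0// => j; rewrite eq_sym => /negbTE->.
rewrite exchange_big/= -[RHS]IHn; apply: eq_bigr => k _.
by rewrite -mulr_sumr Q1 mulr1.
Qed.

Lemma stationary_mpow (R : realType) (S : finType) (Q : S -> S -> R) p n j :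
  stationary Q p -> \sum_i p i * mpow Q n i j = p j.
Proof.
move=> [_ [_ pQ]]; elim: n j => [|n IHn] j /=.
  rewrite (bigD1 j)//= eqxx mulr1 big1 ?addr0// => i /negbTE->.
  by rewrite mulr0.
under eq_bigr do rewrite mulr_sumr.
rewrite exchange_big/= [RHS]pQ; apply: eq_bigr => k _.
rewrite -(IHn k) mulr_suml; apply: eq_bigr => i _.
by rewrite mulrA.
Qed.

(** Invariance gives [p = p Q^n] for every [n], so a zero of [p] at [s] spreads to every state that
    reaches [s]. By irreducibility [p] would vanish, against total mass 1. *)
Lemma stationary_gt0 (R : realType) (S : finType) (Q : S -> S -> R) p s :
  stochastic Q -> irreducible Q -> stationary Q p -> 0 < p s.
Proof.
move=> sQ iQ sp; have [p0 [p1 _]] := sp.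
rewrite lt_def p0 andbT; apply/negP => /eqP ps0.
have pz i : p i = 0.
  have [n Qn] := iQ i s.
  have /eqP := stationary_mpow n s sp; rewrite ps0 psumr_eq0; last first.
    by move=> k _; rewrite mulr_ge0// mpow_ge0.
  move=> /allP/(_ i (mem_index_enum _))/=; rewrite mulf_eq0 (gt_eqF Qn) orbF.
  by move/eqP.
by move: p1; rewrite big1// => /eqP; rewrite eq_sym oner_eq0.
Qed.

Lemma harmonic_mpow (R : realType) (S : finType) (Q : S -> S -> R) v n i :
  (forall i, v i = \sum_j Q i j * v j) -> v i = \sum_j mpow Q n i j * v j.
Proof.
move=> vQ; elim: n => [|n IHn] /=.
  rewrite (bigD1 i)//= eqxx mul1r big1 ?addr0// => j.
  by rewrite eq_sym => /negbTE->; rewrite mul0r.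
rewrite IHn; under [RHS]eq_bigr do rewrite mulr_suml.
rewrite exchange_big/=; apply: eq_bigr => k _.
by rewrite vQ mulr_sumr; apply: eq_bigr => j _; rewrite mulrA.
Qed.

(* Maximum principle: propagate the maximal value of [v] along the chain. *)
Lemma harmonic_const (R : realType) (S : finType) (Q : S -> S -> R) v i j :
  stochastic Q -> irreducible Q -> (forall i, v i = \sum_j Q i j * v j) ->
  v i = v j.
Proof.
move=> sQ iQ vQ.
case: (@Order.TotalTheory.arg_maxP _ _ S i xpredT v isT) => m _ vm.
have vE k : v k = v m.
  have [n Qn] := iQ m k.
  have : \sum_l mpow Q n m l * (v m - v l) = 0.
    under eq_bigr do rewrite mulrBr.
    by rewrite sumrB -mulr_suml mpow_sum1// mul1r -harmonic_mpow// subrr.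
  move/eqP; rewrite psumr_eq0; last first.
    by move=> l _; rewrite mulr_ge0 ?mpow_ge0// subr_ge0; exact: vm.
  move=> /allP/(_ k (mem_index_enum _))/=; rewrite mulf_eq0 (gt_eqF Qn)/=.
  by rewrite subr_eq0 => /eqP.
by rewrite !vE.
Qed.

(** The matrix I - Q + 1 p, the inverse of the fundamental matrix of the chain. The rank-one term
    removes the constants from the kernel of I - Q; [R^o] makes the functions on [S] a
    finite-dimensional space. *)
Definition poisson_op (R : realType) (S : finType) (Q : S -> S -> R)
    (p : S -> R) (h : {ffun S -> R^o}) : {ffun S -> R^o} :=
  [ffun s => h s - \sum_j Q s j * h j + \sum_j p j * h j].

Lemma poisson_op_linear (R : realType) (S : finType) (Q : S -> S -> R) p :
  linear (poisson_op Q p).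
Proof.
move=> a u v; apply/ffunP => s; rewrite !ffunE.
have lin (w : S -> R) : \sum_j w j * (a *: u + v) j =
    a * (\sum_j w j * u j) + \sum_j w j * v j.
  rewrite mulr_sumr -big_split/=; apply: eq_bigr => j _.
  by rewrite !ffunE /GRing.scale/=; ring.
by rewrite !lin /GRing.scale/=; ring.
Qed.

(* [I - Q + 1 p] is injective, hence onto; a preimage of [r - (p.r) 1] solves
   the Poisson equation since multiplying by [p] on the left gives [p.h = 0]. *)
Lemma poisson_equation (R : realType) (S : finType) (Q : S -> S -> R) p r :
  stochastic Q -> irreducible Q -> stationary Q p ->
  exists h : S -> R,
    forall s, r s + \sum_j Q s j * h j - h s = \sum_s p s * r s.
Proof.
move=> sQ iQ sp; have [_ [p1 pQ]] := sp.
pose L := GRing.isLinear.Build R {ffun S -> R^o} {ffun S -> R^o} _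
  (poisson_op Q p) (poisson_op_linear Q p).
pose F : {linear {ffun S -> R^o} -> {ffun S -> R^o}} :=
  HB.pack (poisson_op Q p) L.
have FE h : linfun F h = poisson_op Q p h by rewrite lfunE.
(* Left multiplication by [p] kills I - Q and sends the rank-one term to [p]. *)
have pF (h : {ffun S -> R^o}) :
    \sum_s p s * poisson_op Q p h s = \sum_s p s * h s.
  under eq_bigr do rewrite ffunE mulrDr mulrBr.
  rewrite big_split/= sumrB -mulr_suml p1 mul1r.
  rewrite [X in _ - X + _](_ : _ = \sum_j p j * h j) ?subrr ?add0r//.
  under eq_bigr do rewrite mulr_sumr.
  rewrite exchange_big/=; apply: eq_bigr => j _; rewrite pQ mulr_suml.
  by apply: eq_bigr => i _; rewrite mulrA.
have kF : lker (linfun F) == 0%VS.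
  apply/eqP/vspaceP => h; rewrite memv_ker memv0; apply/idP/idP; last first.
    by move=> /eqP ->; rewrite linear0.
  rewrite FE => /eqP Fh.
  have ph : \sum_s p s * h s = 0.
    by rewrite -pF Fh big1// => s _; rewrite ffunE mulr0.
  (* Since [p.h = 0], a kernel element is harmonic, hence constant; its value is [p.h], that is
     0. *)
  have hQ i : h i = \sum_j Q i j * h j.
    move/ffunP : Fh => /(_ i); rewrite !ffunE ph addr0 => /eqP.
    by rewrite subr_eq0 => /eqP.
  apply/eqP/ffunP => i; rewrite ffunE.
  transitivity (\sum_s p s * h i); first by rewrite -mulr_suml p1 mul1r.
  transitivity (\sum_s p s * h s); last exact: ph.
  apply: eq_bigr => j _; congr (_ * _).
  exact: (@harmonic_const _ _ Q h).
pose m := \sum_s p s * r s.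
pose h := ((linfun F)^-1)%VF ([ffun s => (r s - m : R^o)] : {ffun S -> R^o}).
have Fh : poisson_op Q p h = [ffun s => (r s - m : R^o)].
  by rewrite -FE lker0_lfunVK.
have ph : \sum_s p s * h s = 0.
  rewrite -pF Fh; under eq_bigr do rewrite ffunE mulrBr.
  by rewrite sumrB -mulr_suml p1 mul1r subrr.
exists h => s; move/ffunP : Fh => /(_ s).
by rewrite !ffunE ph -/m => /eqP Fs; apply/eqP; move: Fs; lra.
Qed.

(** * Occupation measures and uniqueness of the LP solution *)

Section LP_policies.
Variables (R : realType) (S A : finType) (As : S -> {set A}).
Variable P : S -> A -> S -> R.
Hypothesis HP : forall s a, a \in As s ->
  (forall s', 0 <= P s a s') /\ \sum_s' P s a s' = 1.

Lemma chain_of_stochastic b : allowed_policy As b -> stochastic (chain_of P b).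
Proof.
move=> ab; split=> [s s'|s]; have [h0 h1] := HP (ab s); first exact: h0.
exact: h1.
Qed.

(** The reduced cost of the LP column [(s, a)] for the dual variables [h] (balance equations) and
    [c] (total mass). *)
Definition advantage (Th : S -> A -> R) (h : S -> R) (c : R) s a :=
  Th s a + \sum_s' P s a s' * h s' - h s - c.

(** The balance constraints cancel the [h] terms against each other, and the mass constraint turns
    the [c] terms into the constant [c]. *)
Lemma LP_obj_advantage Th h c p : LP_feasible As P p ->
  LP_obj As Th p = c + LP_obj As (advantage Th h c) p.
Proof.
move=> [_ [p1 pP]]; rewrite /LP_obj /advantage.
have hE : \sum_s \sum_(a in As s) p s a * h s =
    \sum_s \sum_(a in As s) p s a * \sum_s' P s a s' * h s'.
  under eq_bigr do rewrite -mulr_suml pP mulr_suml.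
  rewrite exchange_big/=; apply: eq_bigr => s _.
  under [LHS]eq_bigr do rewrite mulr_suml.
  rewrite exchange_big/=; apply: eq_bigr => a _; rewrite mulr_sumr.
  by apply: eq_bigr => s' _; rewrite mulrA.
have cE : \sum_s \sum_(a in As s) p s a * c = c.
  by under eq_bigr do rewrite -mulr_suml; rewrite -mulr_suml p1 mul1r.
transitivity (c + (\sum_s \sum_(a in As s) p s a * Th s a
  + (\sum_s \sum_(a in As s) p s a * \sum_s' P s a s' * h s')
  - (\sum_s \sum_(a in As s) p s a * h s)
  - (\sum_s \sum_(a in As s) p s a * c))); first by rewrite hE cE; ring.
congr (_ + _); rewrite -big_split/= -!sumrB; apply: eq_bigr => s _.
by rewrite -big_split/= -!sumrB; apply: eq_bigr => a _; ring.
Qed.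

Definition policy_measure (q : S -> R) (b : policy S A) s a : R :=
  if a == b s then q s else 0.

Lemma sum_policy_measure q b s (g : A -> R) : allowed_policy As b ->
  \sum_(a in As s) policy_measure q b s a * g a = q s * g (b s).
Proof.
move=> ab; rewrite (bigD1 (b s))//= /policy_measure eqxx big1 ?addr0//.
by move=> a /andP[_ /negbTE->]; rewrite mul0r.
Qed.

Lemma policy_measure_feasible q b : allowed_policy As b ->
  stationary (chain_of P b) q -> LP_feasible As P (policy_measure q b).
Proof.
move=> ab [q0 [q1 qP]].
have sumE s : \sum_(a in As s) policy_measure q b s a = q s.
  rewrite -[RHS]mulr1 -(@sum_policy_measure q b s (fun=> 1))//.
  by under [RHS]eq_bigr do rewrite mulr1.
split=> [s a _|]; first by rewrite /policy_measure; case: ifP.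
split=> [|s]; first by rewrite -[RHS]q1; exact: eq_bigr.
rewrite sumE qP; apply: eq_bigr => s' _.
by rewrite (@sum_policy_measure q b s' (fun a => P s' a s)).
Qed.

Lemma LP_obj_policy_measure q b Th : allowed_policy As b ->
  LP_obj As Th (policy_measure q b) = rho q b Th.
Proof.
move=> ab; apply: eq_bigr => s _.
exact: (@sum_policy_measure q b s (Th s)).
Qed.

Definition deviate (b : policy S A) s a : policy S A :=
  [ffun s' => if s' == s then a else b s'].

Lemma deviate_allowed b s a : allowed_policy As b -> a \in As s ->
  allowed_policy As (deviate b s a).
Proof.
by move=> ab aA s'; rewrite ffunE; case: eqP => [->|_]; last exact: ab.
Qed.

Lemma deviate_neq (b : policy S A) s a : a != b s -> deviate b s a != b.
Proof.
by apply: contra => /eqP/ffunP/(_ s); rewrite ffunE eqxx => ->.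
Qed.

Variable pi : policy S A -> S -> R.
Hypothesis Herg : forall b, allowed_policy As b -> irreducible (chain_of P b).
Hypothesis Hpi : forall b, allowed_policy As b ->
  stationary (chain_of P b) (pi b).

(* With [h] solving the Poisson equation of [b], the advantage of [b] is zero
   along [b], so [rho] of a deviation at [s] differs from that of [b] by a
   positive multiple of the advantage at [(s, a)]. *)
Lemma LP_argmax_unique Th b p c : allowed_policy As b ->
  (forall s a, a \in As s -> a != b s ->
     rho (pi (deviate b s a)) (deviate b s a) Th < rho (pi b) b Th) ->
  LP_optimal As P Th p -> argmax_policy As p c -> c = b.
Proof.
move=> ab bbest [fp op] ac.
have stb := chain_of_stochastic ab.
have [h hE] := poisson_equation (fun s => Th s (b s)) stb (Herg ab) (Hpi ab).
set r := rho (pi b) b Th; pose adv := advantage Th h r.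
have adv0 s : adv s (b s) = 0 by rewrite /adv /advantage hE subrr.
have adv_lt0 s a : a \in As s -> a != b s -> adv s a < 0.
  move=> aA nab; have ad := deviate_allowed ab aA.
  have q0 := stationary_gt0 s (chain_of_stochastic ad) (Herg ad) (Hpi ad).
  have := bbest _ _ aA nab; rewrite -LP_obj_policy_measure//.
  rewrite (LP_obj_advantage _ h r (policy_measure_feasible ad (Hpi ad))).
  rewrite -/r -/adv gtrDl LP_obj_policy_measure// /rho (bigD1 s)//= big1.
    by rewrite addr0 ffunE eqxx pmulr_rlt0.
  by move=> s' /negbTE s's; rewrite ffunE s's adv0 mulr0.
have [p0 [p1 pP]] := fp.
have adv_le0 s a : a \in As s -> p s a * adv s a <= 0.
  move=> aA; rewrite mulr_ge0_le0 ?p0//.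
  by have [->|/(adv_lt0 _ _ aA)/ltW//] := eqVneq a (b s); rewrite adv0.
(* The occupation measure of [b] is feasible with value [r], so by optimality the total advantage
   under [p] is at least 0. All its terms are at most 0, hence each is 0, and a strictly negative
   advantage forces [p s a = 0]. *)
have p_eq0 s a : a \in As s -> a != b s -> p s a = 0.
  move=> aA nab; have := op _ (policy_measure_feasible ab (Hpi ab)).
  rewrite LP_obj_policy_measure// (LP_obj_advantage _ h r fp)// -/r -/adv lerDl.
  move=> adv_ge0; have /eqP : LP_obj As adv p = 0.
    apply/eqP; rewrite eq_le adv_ge0 andbT.
    by apply: sumr_le0 => s' _; apply: sumr_le0 => a' /adv_le0.
  rewrite -oppr_eq0 /LP_obj -sumrN psumr_eq0; last first.
    by move=> s' _; rewrite oppr_ge0; apply: sumr_le0 => a' /adv_le0.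
  move=> /allP/(_ s (mem_index_enum _))/=; rewrite -sumrN psumr_eq0; last first.
    by move=> a' /adv_le0; rewrite oppr_ge0.
  move=> /allP/(_ a (mem_index_enum _))/=; rewrite aA/= oppr_eq0 mulf_eq0.
  by rewrite (lt_eqF (adv_lt0 _ _ aA nab)) orbF => /eqP.
have sumE s g : \sum_(a in As s) p s a * g a = p s (b s) * g (b s).
  rewrite (bigD1 (b s))//= big1 ?addr0// => a /andP[aA nab].
  by rewrite p_eq0// mul0r.
have sum1E s : \sum_(a in As s) p s a = p s (b s).
  rewrite -[RHS]mulr1 -(sumE s (fun=> 1)).
  by under [RHS]eq_bigr do rewrite mulr1.
(* Being carried by [b], [p] restricts to a stationary law of the chain of [b]. That law is positive
   everywhere, so [b s] is the only maximizer of [p s] at each [s]. *)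
have stp : stationary (chain_of P b) (fun s => p s (b s)).
  split=> [s|]; first exact: p0.
  split=> [|s]; first by rewrite -[RHS]p1; apply: eq_bigr => s _; rewrite sum1E.
  rewrite -sum1E pP; apply: eq_bigr => s' _.
  exact: (sumE s' (fun a => P s' a s)).
apply/ffunP => s; apply/eqP; apply/negPn/negP => ncb.
have [cA /(_ _ (ab s))] := ac s.
rewrite (p_eq0 s (c s) cA ncb) leNgt => /negP; apply.
exact: (stationary_gt0 s stb (Herg ab) stp).
Qed.

End LP_policies.

(** * Independence *)

Section decoupling.
Local Open Scope ereal_scope.
Context d dX (T : measurableType d) (X : measurableType dX) (R : realType).
Variables (mu : {measure set T -> \bar R}) (nu : {measure set X -> \bar R}).
Variables (Z : T -> R) (Y : T -> X) (c : R).
Hypotheses (mZ : measurable_fun setT Z) (Z0 : forall w, (0 <= Z w)%R).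
Hypothesis mY : measurable_fun setT Y.
Hypothesis ZY : forall C, measurable C ->
  \int[mu]_w (Z w * \1_C (Y w))%:E = c%:E * nu C.

Import HBNNSimple.

(** [ZY] is the case of an indicator; the two sides are additive over the fibres of [h]. *)
Lemma decouple_nnsfun (h : {nnsfun X >-> R}) :
  \int[mu]_w (Z w * h (Y w))%:E = c%:E * \int[nu]_x (h x)%:E.
Proof.
have mhr r : measurable (h @^-1` [set r]).
  by rewrite -(setTI (_ @^-1` _)); exact: measurable_funP.
have hr0 r x : (0 <= r * \1_(h @^-1` [set r]) x)%R.
  by rewrite -lee_fin EFinM; exact: nnfun_muleindic_ge0.
transitivity (\sum_(r \in range h)
    \int[mu]_w (Z w * (r * \1_(h @^-1` [set r]) (Y w)))%:E).
  rewrite -ge0_integral_fsum//; first last.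
  - by move=> r w _; rewrite lee_fin mulr_ge0.
  - move=> r; apply/measurable_EFinP/measurable_funM => //.
    apply: measurable_funM => //.
    by apply: measurableT_comp => //; exact: measurable_indic.
  apply: eq_integral => w _.
  by rewrite fimfunE !fsbig_finite//= mulr_sumr sumEFin.
transitivity (\sum_(r \in range h) r%:E * (c%:E * nu (h @^-1` [set r]))).
  apply: eq_fsbigr => r _; rewrite -ZY//.
  (* Pulling [r] out of the integral needs [r] nonnegative; a negative [r] has an empty fibre and
     both sides vanish. *)
  have [r0|r0] := ltP r 0%R.
    rewrite preimage_nnfun0// !integral0_eq ?mule0// => w _.
      by rewrite indic0 mulr0.
    by rewrite indic0 !mulr0.
  rewrite -ge0_integralZl_EFin//.
  - by apply: eq_integral => w _; rewrite -EFinM; congr EFin; ring.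
  - by move=> w _; rewrite lee_fin mulr_ge0.
  - apply/measurable_EFinP/measurable_funM => //.
    by apply: measurableT_comp => //; exact: measurable_indic.
under [in RHS]eq_integral do rewrite fimfunE -fsumEFin//.
rewrite ge0_integral_fsum//; last 2 first.
- by move=> r; apply/measurable_EFinP/measurable_funM => //;
     exact: measurable_indic.
- by move=> r x _; rewrite lee_fin.
rewrite ge0_mule_fsumr; last first.
  by move=> r; apply: integral_ge0 => x _; rewrite lee_fin.
apply: eq_fsbigr => r _.
by rewrite integralZl_indic_nnsfun// integral_indic// setIT muleCA.
Qed.

(** Monotone convergence along simple functions increasing to [g]. *)
Lemma decouple (g : X -> R) :
  measurable_fun setT g -> (forall x, (0 <= g x)%R) ->
  \int[mu]_w (Z w * g (Y w))%:E = c%:E * \int[nu]_x (g x)%:E.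
Proof.
move=> mg g0.
have mg' : measurable_fun setT (EFin \o g) by exact/measurable_EFinP.
pose h := nnsfun_approx measurableT mg'.
have hg x : (h n x)%:E @[n --> \oo] --> (g x)%:E.
  by apply: cvg_nnsfun_approx => // y _; rewrite lee_fin.
transitivity (limn (fun n => \int[mu]_w (Z w * h n (Y w))%:E)).
  rewrite -monotone_convergence//; first last.
  - move=> w _ m n mn; rewrite lee_fin ler_wpM2l//.
    exact/lefP/nd_nnsfun_approx.
  - by move=> n w _; rewrite lee_fin mulr_ge0.
  - move=> n; apply/measurable_EFinP/measurable_funM => //.
    exact: measurableT_comp.
  apply: eq_integral => w _; apply/esym/cvg_lim => //.
  under eq_fun do rewrite EFinM.
  by rewrite EFinM; apply: cvgeZl => //; exact: hg.
under eq_fun do rewrite decouple_nnsfun.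
apply/cvg_lim => //; apply: cvgeZl => //.
have <- : \int[nu]_x limn (fun n => (h n x)%:E) = \int[nu]_x (g x)%:E.
  by apply: eq_integral => x _; exact/cvg_lim.
apply: cvg_monotone_convergence => //.
- by move=> n; exact/measurable_EFinP.
- by move=> n x _; rewrite lee_fin.
- by move=> x _ m n mn; rewrite lee_fin; exact/lefP/nd_nnsfun_approx.
Qed.

End decoupling.

Section iid_product.
Context (R : realType) (d dX : measure_display).
Context (T : measurableType d) (X : measurableType dX) (Pr : probability T R).
Variable Xs : nat -> T -> X.
Hypothesis Hiid : iid Pr Xs.

Let mXs n : measurable_fun setT (Xs n). Proof. by have [] := Hiid. Qed.

Let mXs_pre n C : measurable C -> measurable (Xs n @^-1` C).
Proof. by move=> mC; rewrite -[X in measurable X]setTI; exact: mXs. Qed.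

Let cap_indic (I : seq nat) (B : nat -> set X) w :
  \prod_(i <- I) \1_(B i) (Xs i w) =
  \1_(\bigcap_(i in [set` I]) (Xs i @^-1` B i)) w :> R.
Proof.
elim: I => [|i I IHI]; first by rewrite big_nil set_nil bigcap_set0 indicT.
rewrite big_cons IHI (_ : [set` i :: I] = i |` [set` I]).
  by rewrite bigcap_setU1 indicI.
by apply/seteqP; split=> k /=; rewrite in_cons => /predU1P.
Qed.

(* The indices in [I] keep indicator factors: each induction step turns one
   indicator, whose event is arbitrary, into a factor [g]. *)
Lemma iid_integral_prod_mixed (g : X -> R) (m : R) (J I : seq nat)
    (B : nat -> set X) :
  measurable_fun setT g -> (forall x, 0 <= g x) ->
  (\int[Pr]_w (g (Xs 0%N w))%:E = m%:E)%E ->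
  uniq (J ++ I) -> (forall i, measurable (B i)) ->
  (\int[Pr]_w (\prod_(j <- J) g (Xs j w)
               * \prod_(i <- I) \1_(B i) (Xs i w))%:E =
   (m ^+ size J)%:E * Pr (\bigcap_(i in [set` I]) (Xs i @^-1` B i)))%E.
Proof.
move=> mg g0 gm; have [_ [idX indX]] := Hiid.
elim: J I B => [|j J IHJ] I B /= uI mB.
  rewrite expr0 mul1e; under eq_integral do rewrite big_nil mul1r cap_indic.
  rewrite integral_indic ?setIT//.
  by apply: bigcap_measurableType => // i _; exact: mXs_pre.
move: uI => /andP[]; rewrite mem_cat => /norP[jJ jI] uI.
have uI' : uniq (J ++ j :: I).
  by rewrite uniq_catC/= mem_cat negb_or jJ jI uniq_catC.
pose Z w := \prod_(j <- J) g (Xs j w) * \prod_(i <- I) \1_(B i) (Xs i w).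
pose E := \bigcap_(i in [set` I]) (Xs i @^-1` B i).
have PE : (Pr E)%E = (fine (Pr E))%:E.
  rewrite fineK// fin_num_measure//.
  by apply: bigcap_measurableType => // i _; exact: mXs_pre.
have mZ : measurable_fun setT Z.
  apply: measurable_funM.
    by apply: measurable_prod => k _; exact: measurableT_comp.
  apply: measurable_prod => i _.
  by apply: measurableT_comp => //; exact: measurable_indic.
have Z0 w : 0 <= Z w.
  by apply: mulr_ge0; apply: prodr_ge0 => i _ //; rewrite indicE.
(* The induction hypothesis with [j] moved into the indicator list, for an arbitrary event [C], is
   exactly the decoupling hypothesis for [Z] and [Xs j]. Overriding [B] at [j] is harmless on [I],
   which does not contain [j]. *)
have ZC C : measurable C -> (\int[Pr]_w (Z w * \1_C (Xs j w))%:E =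
    (m ^+ size J * fine (Pr E))%:E * pushforward Pr (Xs 0%N) C)%E.
  move=> mC; pose B' i := if i == j then C else B i.
  have mB' i : measurable (B' i) by rewrite /B'; case: ifP.
  have B'E i : i \in I -> B' i = B i.
    by rewrite /B'; case: eqP => // ->; rewrite (negPf jI).
  transitivity (Pr (Xs j @^-1` C) * ((m ^+ size J)%:E * Pr E))%E; last first.
    by rewrite idX// EFinM -PE muleC.
  have := IHJ (j :: I) B' uI' mB'; rewrite indX//; last first.
    by have := uI'; rewrite cat_uniq => /and3P[].
  rewrite big_cons {2}/B' eqxx => IH.
  transitivity (((m ^+ size J)%:E * (Pr (Xs j @^-1` C) * Pr E)))%E; last first.
    by rewrite muleCA.
  rewrite /E indX//; last by have := uI; rewrite cat_uniq => /and3P[].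
  have -> : (\prod_(i <- I) Pr (Xs i @^-1` B i) =
             \prod_(i <- I) Pr (Xs i @^-1` B' i))%E.
    by rewrite big_seq [RHS]big_seq; apply: eq_bigr => i /B'E ->.
  rewrite -IH; apply: eq_integral => w _; rewrite big_cons {1}/B' eqxx.
  rewrite /Z -mulrA; congr (_ * _)%:E; rewrite mulrC; congr (_ * _).
  by rewrite big_seq [RHS]big_seq; apply: eq_bigr => i /B'E ->.
pose mX0 := isMeasurableFun.Build _ _ _ _ _ (mXs 0%N).
pose X0 : {mfun T >-> X} := HB.pack (Xs 0%N) mX0.
have := @decouple _ _ T X R Pr (distribution Pr X0) Z (Xs j) _
  mZ Z0 (mXs j) ZC g mg g0.
rewrite ge0_integral_pushforward//; last 2 first.
- exact/measurable_EFinP.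
- by move=> x _; rewrite lee_fin.
rewrite preimage_setT gm => IH.
rewrite /= exprS -/E PE.
transitivity ((m ^+ size J * fine (Pr E))%:E * m%:E)%E; last first.
  by rewrite -!EFinM; congr EFin; ring.
rewrite -IH; apply: eq_integral => w _; rewrite big_cons /Z; congr EFin.
by ring.
Qed.

Lemma iid_integral_prod (g : X -> R) (m : R) n :
  measurable_fun setT g -> (forall x, 0 <= g x) ->
  (\int[Pr]_w (g (Xs 0%N w))%:E = m%:E)%E ->
  (\int[Pr]_w (\prod_(k < n) g (Xs k w))%:E = (m ^+ n)%:E)%E.
Proof.
move=> mg g0 gm.
have := @iid_integral_prod_mixed g m (iota 0 n) [::] (fun=> set0) mg g0 gm.
rewrite cats0 iota_uniq size_iota set_nil bigcap_set0 probability_setT mule1.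
move=> <- //; apply: eq_integral => w _.
rewrite big_nil mulr1 -(big_mkord xpredT (fun k => g (Xs k w))).
by rewrite /index_iota subn0.
Qed.

End iid_product.

(** * Hoeffding's inequality *)

Lemma is_derive_le (R : realType) (f f' : R -> R) (a b : R) :
  (forall x, is_derive x (1:R) f (f' x)) -> (forall x, a <= x -> f' x <= 0) ->
  a <= b -> f b <= f a.
Proof.
move=> df f'0 ab.
have dfx x : derivable f x 1 by have [] := df x.
apply: (@ler0_derive1_nincry _ f a) => //.
- move=> x; rewrite in_itv/= andbT => ax.
  by rewrite derive1E derive_val f'0// ltW.
- by apply: derivable_within_continuous => x _; exact: dfx.
Qed.

(** On the segment from 0 to [h] the exponential lies below its chord. *)
Lemma convex_expR01 (R : realType) (u h : R) : 0 <= u -> u <= 1 ->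
  expR (h * u) <= 1 - u + u * expR h.
Proof.
move=> u0 u1; have := convex_expR (Itv01 u0 u1) h (0 : R).
by rewrite !convRE/= expR0 mulr0 addr0 mulr1 addrC (mulrC h).
Qed.

(** Hoeffding's lemma for a Bernoulli variable. The ratio of the two sides, as a function of [h], is
    1 at 0 and nonincreasing for nonnegative arguments. *)
Lemma bernoulli_mgf_le (R : realType) (p h : R) : 0 <= p -> p <= 1 -> 0 <= h ->
  1 - p + p * expR h <= expR (p * h + h ^+ 2 / 8).
Proof.
move=> p0 p1 h0.
pose D : R -> R := cst (1 - p) + cst p * expR.
have DE x : D x = 1 - p + p * expR x by [].
have D0 x : 0 < D x by rewrite DE; have := expR_gt0 x; nra.
have dD x : is_derive x (1:R) D (p * expR x).
  by apply: is_derive_eq; rewrite /GRing.scale/= ; ring.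
(* [u] is the derivative of [ln (D x) - p x - x^2 / 8]; with
   [t = p e^x / D x] its own derivative is [t (1 - t) - 1/4]. *)
pose u : R -> R := cst p * expR * (fun x => (D x)^-1) - cst p - cst 4^-1 * id.
have du x : is_derive x (1:R) u
    ((p * expR x / D x) * (1 - p * expR x / D x) - 4^-1).
  have dV := is_deriveV (lt0r_neq0 (D0 x)) (dD x).
  apply: is_derive_eq; rewrite /GRing.scale/= !fctE;
  move: (lt0r_neq0 (D0 x)); move: (D x) => d d0; by field.
have u0 x : 0 <= x -> u x <= 0.
  move=> x0; have -> : 0 = u 0.
    by rewrite /u !fctE DE expR0 mulr1 subrK; field.
  apply: (@is_derive_le _ u _ 0 x du) => // y _.
  move: (_ / _) => t; rewrite subr_le0.
  by have := sqr_ge0 (t - 2^-1); rewrite expr2; lra.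
(* The ratio itself, so that no logarithm is differentiated: its derivative is [F x * u x], and [u]
   is at most 0. *)
pose F : R -> R := D * (expR \o (- (cst p * id + cst 8^-1 * id ^+ 2))).
have FE x : F x = D x * expR (- (p * x + x ^+ 2 / 8)).
  by rewrite /F /= !fctE; congr (_ * expR _); rewrite /=; ring.
have dF x : is_derive x (1:R) F (D x * expR (- (p * x + x ^+ 2 / 8)) * u x).
  apply: is_derive_eq; rewrite /GRing.scale/= /u !fctE /=.
  move: (lt0r_neq0 (D0 x)); move: (D x) => d d0.
  by rewrite (mulrC 8^-1); move: (expR (- _)) (expR x) => e1 e2; field.
suff : F h <= 1.
  by rewrite FE expRN ler_pdivrMr ?expR_gt0// mul1r.
have -> : 1 = F 0.
  by rewrite FE DE expR0 mulr0 expr0n mul0r addr0 oppr0 expR0; ring.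
apply: (@is_derive_le _ F _ 0 h dF) => // x x0.
by rewrite mulr_ge0_le0 ?u0// mulr_ge0 ?expR_ge0// ltW.
Qed.

Lemma bounded_integrable (R : realType) d (T : measurableType d)
    (Pr : probability T R) (f : T -> R) (K : R) :
  measurable_fun setT f -> (forall w, `|f w| <= K) ->
  Pr.-integrable setT (EFin \o f).
Proof.
move=> mf fK; apply: measurable_bounded_integrable => //.
  exact: fin_num_fun_lty.
exists K; split; first exact: num_real.
by move=> M KM w _; exact: le_trans (fK w) (ltW KM).
Qed.

Lemma integral_EFin_Rintegral (R : realType) d (T : measurableType d)
    (Pr : probability T R) (f : T -> R) (K : R) :
  measurable_fun setT f -> (forall w, `|f w| <= K) ->
  (\int[Pr]_w (f w)%:E = (Rintegral Pr setT f)%:E)%E.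
Proof.
move=> mf fK; rewrite fineK//.
exact/integrable_fin_num/(bounded_integrable _ mf fK).
Qed.

Section hoeffding.
Context (R : realType) (d dX : measure_display).
Context (T : measurableType d) (X : measurableType dX) (Pr : probability T R).
Variable Xs : nat -> T -> X.
Hypothesis Hiid : iid Pr Xs.

Let mXs n : measurable_fun setT (Xs n). Proof. by have [] := Hiid. Qed.

(** Integrating the chord bound replaces a variable with values in [0,1] by a Bernoulli variable of
    the same mean. *)
Lemma mgf_le (u : X -> R) (h : R) : measurable_fun setT u ->
  (forall x, 0 <= u x) -> (forall x, u x <= 1) -> 0 <= h ->
  (\int[Pr]_w (expR (h * u (Xs 0%N w)))%:E <=
   (expR (Rintegral Pr setT (fun w => u (Xs 0%N w)) * h + h ^+ 2 / 8))%:E)%E.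
Proof.
move=> mu u0 u1 h0; set p := Rintegral _ _ _.
have mu0 : measurable_fun setT (fun w => u (Xs 0%N w)).
  exact: measurableT_comp.
have pE : (\int[Pr]_w (u (Xs 0%N w))%:E = p%:E)%E.
  by apply: (@integral_EFin_Rintegral _ _ _ _ _ 1) => // w; rewrite ger0_norm.
have p0 : 0 <= p.
  by rewrite -lee_fin -pE integral_ge0// => w _; rewrite lee_fin.
have e1 : 0 <= expR h - 1 by rewrite subr_ge0 -expR0 ler_expR.
have p1 : p <= 1.
  rewrite -lee_fin -pE -(@probability_setT _ _ _ Pr) -[leRHS]mul1e.
  rewrite -integral_cst//.
  apply: ge0_le_integral => //.
  - by move=> w _; rewrite lee_fin.
  - exact/measurable_EFinP.
  - by move=> w _; rewrite lee_fin.
rewrite (@le_trans _ _ (1 - p + p * expR h)%:E)//; last first.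
  by rewrite lee_fin bernoulli_mgf_le.
have -> : (1 - p + p * expR h)%:E = (1 + (expR h - 1)%:E * p%:E)%E.
  by rewrite -EFinM -EFinD; congr EFin; ring.
rewrite -pE -ge0_integralZl_EFin//; last 2 first.
- by move=> w _; rewrite lee_fin.
- exact/measurable_EFinP.
rewrite -(@probability_setT _ _ _ Pr) -[X in (X + _)%E]mul1e -integral_cst//.
rewrite -ge0_integralD//; last 2 first.
- by move=> w _; rewrite mule_ge0// lee_fin.
- by apply: emeasurable_funM => //; exact/measurable_EFinP.
apply: ge0_le_integral => //.
- by apply/measurable_EFinP/measurableT_comp => //; exact: measurable_funM.
- apply: emeasurable_funD => //.
  by apply: emeasurable_funM => //; exact/measurable_EFinP.
- move=> w _; rewrite /cst -EFinM -EFinD lee_fin.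
  by apply: le_trans (convex_expR01 _ _ _) _ => //; lra.
Qed.

(** The Chernoff method: Markov's inequality for the exponential of the sum, whose expectation
    factors by independence. *)
Lemma hoeffding01 (u : X -> R) (n : nat) (eps : R) : measurable_fun setT u ->
  (forall x, 0 <= u x) -> (forall x, u x <= 1) -> 0 <= eps ->
  (Pr [set w | (n%:R * (Rintegral Pr setT (fun w => u (Xs 0%N w)) + eps)
                <= \sum_(k < n) u (Xs k w))%R] <=
   (expR (- (2 * eps ^+ 2)) ^+ n)%:E)%E.
Proof.
move=> mu u0 u1 eps0; set p := Rintegral _ _ _; set E := [set w | _].
have mE : measurable E.
  rewrite -[E]setTI; apply: measurable_fun_le => //.
  by apply: measurable_sum => k; exact: measurableT_comp.
(* This value minimizes [h ^+ 2 / 8 - h * eps]; the minimum is [- (2 * eps ^+ 2)]. *)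
pose h := 4 * eps; have h0 : 0 <= h by rewrite mulr_ge0.
pose g x := expR (h * u x).
have mg : measurable_fun setT g.
  by apply: measurableT_comp => //; exact: measurable_funM.
have g0 x : 0 <= g x by exact: expR_ge0.
have := mgf_le mu u0 u1 h0; rewrite -/p -/(g _) => gle.
have [m gm] : exists m, (\int[Pr]_w (g (Xs 0%N w))%:E = m%:E)%E.
  exists (fine (\int[Pr]_w (g (Xs 0%N w))%:E)%E); rewrite fineK//.
  rewrite ge0_fin_numE; first exact: le_lt_trans gle (ltry _).
  by apply: integral_ge0 => w _; rewrite lee_fin.
have m0 : 0 <= m.
  by rewrite -lee_fin -gm integral_ge0// => w _; rewrite lee_fin.
have mle : m <= expR (p * h + h ^+ 2 / 8) by rewrite -lee_fin -gm.
have -> : (Pr E = \int[Pr]_w (\1_E w)%:E)%E by rewrite integral_indic// setIT.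
(* The Markov constant: on [E] the product of the [g (Xs k w)] is at least the inverse of [c]. *)
pose c := expR (- (h * (n%:R * (p + eps)))).
have c0 : 0 <= c by exact: expR_ge0.
have mprod : measurable_fun setT (fun w => \prod_(k < n) g (Xs k w)).
  by apply: measurable_prod => k _; exact: measurableT_comp.
have prod0 w : 0 <= \prod_(k < n) g (Xs k w) by exact: prodr_ge0.
rewrite (@le_trans _ _ (\int[Pr]_w (c%:E * (\prod_(k < n) g (Xs k w))%:E))%E)//.
  apply: ge0_le_integral => //.
  - exact/measurable_EFinP/measurable_indic.
  - by apply: emeasurable_funM => //; exact/measurable_EFinP.
  - move=> w _; rewrite -EFinM lee_fin indicE.
    have [wE|_] := boolP (w \in E); last exact: mulr_ge0.
    rewrite /g -expR_sum /c -expRD -[leLHS]expR0 ler_expR -mulr_sumr.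
    rewrite addrC subr_ge0 ler_wpM2l//.
    by move: wE; rewrite inE.
rewrite ge0_integralZl_EFin//; last 2 first.
- by move=> w _; rewrite lee_fin.
- exact/measurable_EFinP.
rewrite (iid_integral_prod Hiid n mg g0 gm) -EFinM lee_fin.
rewrite (@le_trans _ _ (c * expR (p * h + h ^+ 2 / 8) ^+ n))//.
  by rewrite ler_wpM2l// lerXn2r// nnegrE expR_ge0.
rewrite -!expRM_natl -expRD ler_expR /h le_eqVlt; apply/orP; left; apply/eqP.
by field.
Qed.

(** [v] stays within [b] of any one of its values; a base point exists because the total mass is
    1. *)
Lemma bounded_oscillation_integrable (v : X -> R) (b : R) (k : nat) :
  measurable_fun setT v -> (forall x y, v x - v y <= b) ->
  Pr.-integrable setT (EFin \o (fun w => v (Xs k w))).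
Proof.
move=> mv vb.
have [w0 _] : [set: T] !=set0.
  apply/set0P/eqP => T0; have := @probability_setT _ _ _ Pr.
  by rewrite T0 measure0 => /eqP; rewrite eq_sym onee_eq0.
pose v0 := v (Xs k w0).
apply: (@bounded_integrable _ _ _ _ _ (`|v0| + b)) => [|w].
  exact: measurableT_comp.
have := vb (Xs k w) (Xs k w0); have := vb (Xs k w0) (Xs k w); rewrite -/v0.
by case: (ler0P v0) => ? ? ?; rewrite ler_norml; lra.
Qed.

(** Shifting by the infimum and dividing by [b] maps [v] into [0,1] and the deviation [t] to
    [t / b]; the event is unchanged. *)
Lemma hoeffding (v : X -> R) (b t : R) (n : nat) : measurable_fun setT v ->
  (forall x y, v x - v y <= b) -> 0 < b -> 0 <= t -> (0 < n)%N ->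
  (Pr [set w | (Rintegral Pr setT (fun w => v (Xs 0%N w)) + t <=
                n%:R^-1 * \sum_(k < n) v (Xs k w))%R] <=
   (expR (- (2 * (t / b) ^+ 2)) ^+ n)%:E)%E.
Proof.
move=> mv vb b0 t0 n0.
have [w0 _] : [set: T] !=set0.
  apply/set0P/eqP => T0; have := @probability_setT _ _ _ Pr.
  by rewrite T0 measure0 => /eqP; rewrite eq_sym onee_eq0.
pose a := inf (range v).
have hi : has_inf (range v).
  split; first by exists (v (Xs 0%N w0)), (Xs 0%N w0).
  exists (v (Xs 0%N w0) - b) => _ [x _ <-].
  by have := vb (Xs 0%N w0) x; lra.
have av x : a <= v x by apply: ge_inf; [exact: hi.2|exists x].
have vab x : v x - b <= a.
  apply: lb_le_inf; first exact: hi.1.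
  by move=> _ [y _ <-]; have := vb x y; lra.
pose u x := b^-1 * (v x - a).
have mu : measurable_fun setT u.
  by apply: measurable_funM => //; exact: measurable_funB.
have u0 x : 0 <= u x by rewrite mulr_ge0// ?invr_ge0 ?subr_ge0// ltW.
have u1 x : u x <= 1.
  by rewrite /u mulrC ler_pdivrMr// mul1r; have := vab x; lra.
have iv := bounded_oscillation_integrable 0 mv vb.
have ia : Pr.-integrable setT (EFin \o (fun=> a)).
  by apply: (@bounded_integrable _ _ _ _ _ `|a|).
have := hoeffding01 n mu u0 u1 (divr_ge0 t0 (ltW b0)).
rewrite RintegralZl//; last first.
  apply: (@bounded_integrable _ _ _ _ _ b) => [|w].
    by apply: measurable_funB => //; exact: measurableT_comp.
  by have := av (Xs 0%N w); have := vab (Xs 0%N w); rewrite ler_norml; lra.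
rewrite RintegralB// Rintegral_cst// [fine _](_ : _ = 1) ?mulr1; last first.
  exact: (congr1 fine (probability_setT Pr)).
congr ((Pr _ <= _)%E); apply: eq_set => w; congr is_true.
rewrite -mulr_sumr sumrB sumr_const card_ord -[a *+ n]mulr_natl.
rewrite [RHS]ler_pdivlMl ?ltr0n// -[RHS](lerD2r (- (n%:R * a))).
rewrite -[RHS](ler_pM2l (x := b^-1)) ?invr_gt0//.
by congr (_ <= _); ring.
Qed.

Lemma hoeffding_lower (v : X -> R) (b t : R) (n : nat) :
  measurable_fun setT v ->
  (forall x y, v x - v y <= b) -> 0 < b -> 0 <= t -> (0 < n)%N ->
  (Pr [set w | (n%:R^-1 * \sum_(k < n) v (Xs k w) <=
                Rintegral Pr setT (fun w => v (Xs 0%N w)) - t)%R] <=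
   (expR (- (2 * (t / b) ^+ 2)) ^+ n)%:E)%E.
Proof.
move=> mv vb b0 t0 n0.
have mN : measurable_fun setT (fun x => - v x) by exact: measurableT_comp.
have vbN x y : - v x - - v y <= b by have := vb y x; lra.
have := hoeffding mN vbN b0 t0 n0.
have -> : \int[Pr]_w (- v (Xs 0%N w)) = - \int[Pr]_w v (Xs 0%N w).
  rewrite -mulN1r -RintegralZl//; last first.
    exact: bounded_oscillation_integrable mv vb.
  by apply: eq_Rintegral => w _; rewrite mulN1r.
congr ((Pr _ <= _)%E); apply: eq_set => w; congr is_true.
by rewrite sumrN mulrN lerNr opprD opprK.
Qed.

End hoeffding.

Lemma union_bound (R : realType) d (T : measurableType d)
    (Pr : probability T R) (I : finType) (E : I -> set T) (D : set T) (c : R) :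
  measurable D -> (forall i, measurable (E i)) ->
  (forall w, D w -> exists i, E i w) ->
  (forall i, Pr (E i) <= c%:E)%E -> (Pr D <= (#|I|%:R * c)%:E)%E.
Proof.
move=> mD mE DE Ec.
have -> : (Pr D = \int[Pr]_w (\1_D w)%:E)%E by rewrite integral_indic// setIT.
rewrite (@le_trans _ _ (\int[Pr]_w (\sum_(i : I) (\1_(E i) w)%:E))%E)//.
  apply: ge0_le_integral => //.
  - exact/measurable_EFinP/measurable_indic.
  - by apply: emeasurable_sum => i; exact/measurable_EFinP/measurable_indic.
  - move=> w _; rewrite sumEFin lee_fin indicE.
    have [wD|_] := boolP (w \in D); last by apply: sumr_ge0 => i _.
    have [i Ei] := DE w (set_mem wD).
    by rewrite (bigD1 i)//= indicE mem_set// lerDl; apply: sumr_ge0.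
rewrite ge0_integral_sum//; last first.
- by move=> i; exact/measurable_EFinP/measurable_indic.
rewrite (@le_trans _ _ (\sum_(i : I) c%:E)%E)//.
  by apply: lee_sum => i _; rewrite integral_indic// setIT; exact: Ec.
by rewrite sumEFin sumr_const cardT -cardE mulr_natl.
Qed.

(** * Counting wrong policies *)

(** The difference is a [q]-average of positive numbers, and [q] charges some state because its mass
    is 1, so strictness survives. *)
Lemma rho_lt (R : realType) (S A : finType) (q : S -> R) (b : policy S A)
    (U V : S -> A -> R) (e : R) :
  (forall s, 0 <= q s) -> \sum_s q s = 1 ->
  (forall s, U s (b s) < V s (b s) + e) -> rho q b U < rho q b V + e.
Proof.
move=> q0 q1 UV; rewrite -subr_gt0.
have -> : rho q b V + e - rho q b U =
    \sum_s q s * (V s (b s) + e - U s (b s)).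
  rewrite -[X in _ + X - _]mul1r -q1 mulr_suml -big_split -sumrB/=.
  by apply: eq_bigr => s _; ring.
have ge0 s : true -> 0 <= q s * (V s (b s) + e - U s (b s)).
  by move=> _; rewrite mulr_ge0// subr_ge0 ltW.
rewrite lt_def sumr_ge0// andbT psumr_eq0//; apply/negP => /allP q0'.
move: q1; rewrite big1 => [/eqP|s _]; first by rewrite eq_sym oner_eq0.
move: (q0' s (mem_index_enum _)); rewrite /= mulf_eq0 subr_eq0 (gt_eqF (UV s)).
by rewrite orbF => /eqP.
Qed.

(** If both alternatives fail, passing from [M] to [Th] raises each deviation by less than [dl / 2]
    and lowers [b] by less than [dl / 2]. The gap [dl] then keeps [b] strictly ahead, and
    [LP_argmax_unique] applies. *)
Lemma wrong_policy_deviation (R : realType) (S A : finType)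
    (As : S -> {set A}) (P : S -> A -> S -> R)
    (HP : forall s a, a \in As s ->
       (forall s', 0 <= P s a s') /\ \sum_s' P s a s' = 1)
    (pi : policy S A -> S -> R)
    (Herg : forall b, allowed_policy As b -> irreducible (chain_of P b))
    (Hpi : forall b, allowed_policy As b -> stationary (chain_of P b) (pi b))
    (M Th : S -> A -> R) (b c : policy S A) (dl : R) (p : S -> A -> R) :
  allowed_policy As b ->
  (forall b', allowed_policy As b' -> b' != b ->
     rho (pi b') b' M <= rho (pi b) b M - dl) ->
  LP_optimal As P Th p -> argmax_policy As p c -> c != b ->
  (exists s a, a \in As s /\ M s a + dl / 2 <= Th s a) \/
  (exists s, Th s (b s) <= M s (b s) - dl / 2).
Proof.
move=> ab gap op ac; apply: contra_neqP => /not_orP[nup nlow].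
apply: (LP_argmax_unique HP Herg Hpi ab _ op ac) => s a aA nab.
have ad := deviate_allowed ab aA.
set b' := deviate b s a.
have lt1 : rho (pi b') b' Th < rho (pi b') b' M + dl / 2.
  have [q0 [q1 _]] := Hpi _ ad; apply: rho_lt => // s'.
  by rewrite ltNge; apply/negP => h; apply: nup; exists s', (b' s').
have lt2 : rho (pi b) b M < rho (pi b) b Th + dl / 2.
  have [q0 [q1 _]] := Hpi _ ab; apply: rho_lt => // s'.
  by rewrite -ltrBlDr ltNge; apply/negP => h; apply: nlow; exists s'.
have := gap _ ad (deviate_neq nab); rewrite -/b'; lra.
Qed.

Lemma expected_count_le (R : realType) d (T : measurableType d)
    (Pr : probability T R) (E : nat -> T -> bool) (c q : R) :
  (forall t, (1 <= t)%N -> measurable [set w | E t w]) ->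
  (forall t, (1 <= t)%N -> Pr [set w | E t w] <= (c * q ^+ t)%:E)%E ->
  0 <= c -> 0 <= q -> q < 1 ->
  (\int[Pr]_w (1 + \sum_(1 <= t <oo) ((E t w)%:R)%:E) <=
   1 + (c * q / (1 - q))%:E)%E.
Proof.
move=> mE PE c0 q0 q1.
have EE t w : ((E t w)%:R = \1_[set w | E t w] w :> R).
  by rewrite indicE; congr (nat_of_bool _)%:R; apply/idP/idP; rewrite inE.
(* The index is shifted so that the series starts at 0; the geometric bound then has first term
   [c * q]. *)
pose F t w : \bar R := ((E t.+1 w)%:R)%:E.
have mF t : measurable_fun setT (F t).
  rewrite (_ : F t = EFin \o \1_[set w | E t.+1 w]).
    by apply/measurable_EFinP/measurable_indic; exact: mE.
  by apply/funext => w; rewrite /F EE.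
have F0 t w : (0 <= F t w)%E by rewrite lee_fin.
have -> : (\int[Pr]_w (1 + \sum_(1 <= t <oo) ((E t w)%:R)%:E) =
    \int[Pr]_w (cst 1 w + \sum_(t <oo) F t w))%E.
  apply: eq_integral => w _; congr (_ + _)%E.
  rewrite -(@nneseries_addn _ (fun t => ((E t w)%:R)%:E) 1); last first.
    by move=> i; rewrite lee_fin.
  by apply: eq_eseriesr => i _; rewrite /F addn1.
rewrite (@ge0_integralD _ _ _ Pr _ measurableT (cst 1%E)
  (fun w => \sum_(t <oo) F t w)%E)//; last 2 first.
- by move=> w _; exact: nneseries_ge0.
- exact: ge0_emeasurable_sum.
rewrite integral_cst// mul1e; apply: leeD.
  exact: probability_le1.
rewrite integral_nneseries//.
have -> : (c * q / (1 - q))%:E = (\sum_(t <oo) (c * q ^+ t.+1)%:E)%E.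
  apply/esym/cvg_lim => //.
  have -> : (fun n => \sum_(0 <= i < n) (c * q ^+ i.+1)%:E)%E =
      EFin \o series (geometric (c * q) q).
    apply/funext => n; rewrite /= /series/= -sumEFin; apply: eq_bigr => i _.
    by rewrite /= exprS mulrA.
  apply: cvg_EFin; first exact: nearW.
  by apply: cvg_geometric_series; rewrite ger0_norm.
apply: lee_nneseries => [i _ _|i _]; first exact: integral_ge0.
apply: le_trans (PE i.+1 _) => //.
rewrite /F; under eq_integral do rewrite EE.
by rewrite integral_indic ?setIT//; exact: mE.
Qed.

Lemma allowedP (S A : finType) (As : S -> {set A}) (b : policy S A) :
  reflect (allowed_policy As b) (allowedb As b).
Proof. exact: forallP. Qed.

Lemma le_B0 (R : realType) (S A : finType) (As : S -> {set A})
    (B : S -> A -> R) s a : a \in As s -> B s a <= B0 As B.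
Proof.
move=> aA; apply: le_trans (le_bigmax _ _ s).
exact: (le_bigmax_cond _ (B s)).
Qed.

(** An empty maximum is [-oo], so the gap is [+oo] exactly when no competitor exists; otherwise the
    maximum is a real number at most the optimal value. *)
Lemma Delta1P (R : realType) (S A : finType) (As : S -> {set A})
    (pi : policy S A -> S -> R) (M : S -> A -> R) (b : policy S A) :
  (forall b', allowed_policy As b' -> rho (pi b') b' M <= rho (pi b) b M) ->
  (Delta1 As pi M b = +oo%E /\ forall b', allowed_policy As b' -> b' = b) \/
  exists dl, [/\ Delta1 As pi M b = dl%:E, 0 <= dl &
    forall b', allowed_policy As b' -> b' != b ->
      rho (pi b') b' M <= rho (pi b) b M - dl].
Proof.
move=> opt; rewrite /Delta1; set m := \big[_/_]_(_ | _) _.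
have mle : (m <= (rho (pi b) b M)%:E)%E.
  apply: bigmax_le; first exact: leNye.
  by move=> b' /andP[/allowedP ab' _]; rewrite lee_fin opt.
have lem b' : allowed_policy As b' -> b' != b -> ((rho (pi b') b' M)%:E <= m)%E.
  move=> /allowedP ab' nb'.
  apply: (le_bigmax_cond _ (fun b0 => (rho (pi b0) b0 M)%:E)).
  by rewrite ab'.
move: mle lem; case: m => [r|//|] mle lem; last first.
  left; split=> // b' ab'; apply/eqP/negPn/negP => nb'.
  by have := lem _ ab' nb'; rewrite leeNy_eq.
right; exists (rho (pi b) b M - r); split => //.
  by rewrite subr_ge0 -lee_fin.
by move=> b' ab' nb'; rewrite subKr -lee_fin lem.
Qed.

Lemma expected_count_never (R : realType) d (T : measurableType d)
    (Pr : probability T R) (E : nat -> T -> bool) :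
  (forall t w, (1 <= t)%N -> E t w = false) ->
  (\int[Pr]_w (1 + \sum_(1 <= t <oo) ((E t w)%:R)%:E) = 1)%E.
Proof.
move=> E0; rewrite (eq_integral (cst 1%E)) => [|w _].
  by rewrite integral_cst// mul1e; exact: probability_setT.
by rewrite eseries0 ?adde0// => t t1 _; rewrite E0.
Qed.

(** * Degenerate cases and assembly of the bound *)

Unset Implicit Arguments. Set Strict Implicit. Set Printing Implicit Defensive.

Theorem theorem1
  (R : realType) (S A : finType) (As : S -> {set A})
  (HAs : forall s, As s != finset.set0 :> {set A})
  (P : S -> A -> S -> R)
  (HP : forall s a, a \in As s ->
          (forall s', 0 <= P s a s') /\ \sum_(s' : S) P s a s' = 1)
  (pi : policy S A -> S -> R)
  (Herg : forall b, allowed_policy As b ->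
          irreducible (chain_of P b) /\ aperiodic (chain_of P b))
  (Hpi : forall b, allowed_policy As b -> stationary (chain_of P b) (pi b))
  (d : measure_display) (T : measurableType d) (Pr : probability T R)
  (dX : measure_display) (X : measurableType dX) (Xs : nat -> T -> X)
  (Hiid : iid Pr Xs)
  (f : S -> A -> X -> R)
  (Hf : forall s a, a \in As s -> measurable_fun setT (f s a))
  (B : S -> A -> R)
  (HB : forall s a, a \in As s -> forall x y : X, f s a x - f s a y <= B s a)
  (M : S -> A -> R)
  (HM : forall s a, a \in As s ->
          M s a = Rintegral Pr setT (fun w => f s a (Xs 0%N w)))
  (bstar : policy S A) (Hbs : allowed_policy As bstar)
  (Hopt : forall b, allowed_policy As b ->
          rho (pi b) b M <= rho (pi bstar) bstar M)
  (beta : nat -> T -> policy S A)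
  (Hbeta : forall (n : nat) (w : T), (1 <= n)%N ->
          exists p : S -> A -> R,
            LP_optimal As P (Theta f (fun k => Xs k w) n) p /\
            argmax_policy As p (beta n w))
  (Hmeas : forall n : nat, (1 <= n)%N -> measurable [set w | beta n w != bstar]) :
  (\int[Pr]_w (1 + \sum_(1 <= t <oo) ((beta t w != bstar)%:R)%:E)
   <= 1 + ediv_pos ((1 + #|A|)%:R * #|S|%:R)
            (expm1_ext (half_sq_ratio (Delta1 As pi M bstar) (B0 As B))))%E.
Proof.
have never : (forall t w, (1 <= t)%N -> beta t w = bstar) ->
    (\int[Pr]_w (1 + \sum_(1 <= t <oo) ((beta t w != bstar)%:R)%:E) <= 1)%E.
  move=> betaE; rewrite (expected_count_never Pr)// => t w t1.
  by rewrite betaE// eqxx.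
have [[-> uniqb]|[dl [-> dl0 gap]]] := Delta1P Hopt.
  (* With an infinite gap the fraction is 0, and the only allowed policy is always played. *)
  rewrite /= adde0; apply: never => t w t1; apply: uniqb => s.
  by have [p [_ /(_ s)[]]] := Hbeta t w t1.
(* A zero gap makes the denominator [expR 0 - 1] vanish, so the bound is [+oo]. *)
rewrite /=; have [dlz|dln0] := eqVneq dl 0.
  by rewrite /= expR0 subrr eqxx addey// leey.
have dlpos : 0 < dl by rewrite lt_def dln0.
have wrong t w : (1 <= t)%N -> beta t w != bstar ->
    (exists s a, a \in As s /\
       M s a + dl / 2 <= Theta f (fun k => Xs k w) t s a) \/
    (exists s, Theta f (fun k => Xs k w) t s (bstar s)
       <= M s (bstar s) - dl / 2).
  move=> t1 nb; have [p [op ap]] := Hbeta t w t1.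
  apply: (wrong_policy_deviation HP _ Hpi Hbs gap op ap nb) => b ab.
  by have [] := Herg b ab.
have HB0 s a : a \in As s -> forall x y, f s a x - f s a y <= B0 As B.
  by move=> aA x y; exact: le_trans (HB _ _ aA x y) (le_B0 _ aA).
(* With zero range the fraction is 0. Rewards do not depend on the sample, so the averages equal
   their means and [wrong] would give [dl / 2 <= 0]. *)
have [bz|bn0] := eqVneq (B0 As B) 0.
  rewrite /= adde0; apply: never => t w t1.
  have ThM s a : a \in As s -> Theta f (fun k => Xs k w) t s a = M s a.
    move=> aA; have fc x y : f s a x = f s a y.
      by have := HB0 _ _ aA x y; have := HB0 _ _ aA y x; rewrite bz; lra.
    rewrite /Theta HM//.
    rewrite (@eq_Rintegral _ _ _ _ _ (fun=> f s a (Xs 0%N w))) => [|w' _].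
      rewrite Rintegral_cst// [fine _](_ : _ = 1) ?mulr1; last first.
        exact: (congr1 fine (probability_setT Pr)).
      rewrite (eq_bigr (fun=> f s a (Xs 0%N w))) => [|k _]; last exact: fc.
      rewrite sumr_const card_ord -[f _ _ _ *+ _]mulr_natl.
      by rewrite mulKf// pnatr_eq0 -lt0n.
    exact: fc.
  apply/eqP/negPn/negP => /(wrong _ _ t1)[[s [a [aA]]]|[s]]; rewrite ThM//; lra.
have bpos : 0 < B0 As B.
  by rewrite lt_def bn0; apply: bigmax_ge_id.
set b0 := B0 As B in bpos HB0 *; set z := (dl / b0) ^+ 2 / 2.
pose q := expR (- z); pose c : R := (1 + #|A|)%:R * #|S|%:R.
have z0 : 0 < z by rewrite divr_gt0// exprn_gt0// divr_gt0.
have ez : expR z - 1 != 0 by rewrite subr_eq0 gt_eqF// -expR0 ltr_expR.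
rewrite /= (negPf ez) -/c.
(* The sum over [t >= 1] of [c * q ^+ t]. *)
have -> : c / (expR z - 1) = c * q / (1 - q).
  rewrite /q expRN; have := lt0r_neq0 (expR_gt0 z) => en0; field.
  by rewrite en0 ez.
have q1 : q < 1 by rewrite /q -expR0 ltr_expR oppr_lt0.
apply: expected_count_le => //; last 2 first.
- by rewrite mulr_ge0.
- exact: expR_ge0.
move=> t t1.
(* The index type has (1 + A) S elements, the constant of the bound. Pairs that are not allowed get
   the empty event, since [f] is controlled on allowed pairs only. *)
pose E (i : (S * A) + S) : set T := match i with
  | inl sa => if sa.2 \in As sa.1 then
      [set w | M sa.1 sa.2 + dl / 2 <=
               t%:R^-1 * \sum_(k < t) f sa.1 sa.2 (Xs k w)]
      else set0
  | inr s => [set w | t%:R^-1 * \sum_(k < t) f s (bstar s) (Xs k w)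
                      <= M s (bstar s) - dl / 2]
  end.
have mavg s a : a \in As s ->
    measurable_fun setT (fun w => t%:R^-1 * \sum_(k < t) f s a (Xs k w)).
  move=> aA; apply: measurable_funM => //; apply: measurable_sum => k.
  by apply: measurableT_comp; [exact: Hf|have [] := Hiid].
have mE i : measurable (E i).
  case: i => [[s a]|s] /=.
    case: ifPn => // aA; rewrite -[X in measurable X]setTI.
    by apply: measurable_fun_le => //; exact: mavg.
  rewrite -[X in measurable X]setTI.
  by apply: measurable_fun_le => //; exact: mavg.
(* Hoeffding at deviation [dl / 2] has exponent [2 * (dl / 2 / b0) ^+ 2], which is [z]. *)
have qE : q = expR (- (2 * (dl / 2 / b0) ^+ 2)).
  by rewrite /q /z; congr expR; field; rewrite gt_eqF.
have dl20 : 0 <= dl / 2 by rewrite divr_ge0.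
have PE i : (Pr (E i) <= (q ^+ t)%:E)%E.
  rewrite qE; case: i => [[s a]|s] /=.
    case: ifPn => [aA|_]; last by rewrite measure0 lee_fin exprn_ge0// expR_ge0.
    rewrite HM//; exact: (hoeffding Hiid (Hf _ _ aA) (HB0 _ _ aA)).
  rewrite HM//.
  exact: (hoeffding_lower Hiid (Hf _ _ (Hbs s)) (HB0 _ _ (Hbs s))).
have -> : c = #|{: (S * A) + S}|%:R.
  by rewrite card_sum card_prod /c -natrM mulnDl mul1n addnC mulnC.
apply: (union_bound (Hmeas _ t1) mE _ PE) => w /(wrong _ _ t1)[].
  by move=> [s [a [aA le]]]; exists (inl (s, a)); rewrite /E /= aA.
by move=> [s le]; exists (inr s).
Qed.
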